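(* Let $n$ be a non-negative integer. If $\{(s_k),(\sigma_k)\}$, $k=0,1,2,\ldots$, is a binomial-transform pair of the first kind and $\{(\bar t_k),(\bar\tau_k)\}$, $k=0,1,2,\ldots$, is a binomial-transform pair of the second kind, then \[ \sum_{k=0}^n \binom{n}{k} s_k\,\bar t_{n-k} = \sum_{k=0}^n (-1)^k\binom{n}{k}\sigma_k\,\bar\tau_{n-k}. \]
   Context: Sequences $(s_k)_{k\ge0},(\sigma_k)_{k\ge0}$ of complex numbers form a binomial-transform pair of the first kind if $\sigma_n=\sum_{k=0}^n(-1)^k\binom nk s_k$ for all $n\ge0$. Sequences $(\bar t_k)_{k\ge0},(\bar\tau_k)_{k\ge0}$ of complex numbers form a binomial-transform pair of the second kind if $\bar\tau_n=\sum_{k=0}^n\binom nk\bar t_k$ for all $n\ge0$. *)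

(* Defs.v *)
From mathcomp Require Import all_boot all_order all_algebra.
From mathcomp Require Import reals.
From mathcomp Require Import complex.

Set Implicit Arguments.
Unset Strict Implicit.
Unset Printing Implicit Defensive.

Import GRing.Theory.

Local Open Scope ring_scope.
Local Open Scope complex_scope.

(* The complex numbers are R[i] for R : realType, a model of the real line. *)

Definition binomial_pair1 (R : realType) (s sigma : nat -> R[i]) : Prop :=
  forall n : nat,
    sigma n = \sum_(0 <= k < n.+1) (-1) ^+ k * 'C(n, k)%:R * s k.

(* The bars on the second-kind sequences are part of their names; they do not
   denote complex conjugation. *)
Definition binomial_pair2 (R : realType) (t tau : nat -> R[i]) : Prop :=
  forall n : nat,
    tau n = \sum_(0 <= k < n.+1) 'C(n, k)%:R * t k.

(* Main.v *)
(* Both sides are twisted binomial convolutions. Writing E for the shift, such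
   a convolution satisfies (a * b)(n+1) = x (Ea * b)(n) + (a * Eb)(n). For the
   constant sequence b = 1 this shows that the transform of E s is
   sigma - E sigma and that of E t is E tau - tau, so, by induction on n for all
   sequences at once, the two sides of the identity satisfy the same
   recurrence. *)

Require Import Defs.
From mathcomp Require Import all_boot all_order all_algebra.
From mathcomp Require Import reals.
From mathcomp Require Import complex.

Set Implicit Arguments.
Unset Strict Implicit.
Unset Printing Implicit Defensive.

Import GRing.Theory.

Local Open Scope ring_scope.
Local Open Scope complex_scope.

(** The weight [x] serves both signs: [x = 1] gives the left side of the identity and [x = -1] the
    right. With [b] constantly 1, [x = -1] gives the first-kind transform and [x = 1] the second. *)
Definition binomial_conv (A : comPzRingType) (x : A) (a b : nat -> A) (n : nat) :=
  \sum_(0 <= k < n.+1) x ^+ k * 'C(n, k)%:R * a k * b (n - k)%N.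

Section BinomialConvolution.
Variable A : comPzRingType.
Implicit Types (x : A) (a b s t : nat -> A) (n : nat).

Lemma eq_binomial_conv x a a' b b' n :
  a =1 a' -> b =1 b' -> binomial_conv x a b n = binomial_conv x a' b' n.
Proof. by move=> ea eb; apply: eq_bigr => k _; rewrite ea eb. Qed.

Lemma binomial_convBl x a a' b n :
  binomial_conv x (fun k => a k - a' k) b n =
  binomial_conv x a b n - binomial_conv x a' b n.
Proof. by rewrite -sumrB; apply: eq_bigr => k _; rewrite mulrBr mulrBl. Qed.

Lemma binomial_convBr x a b b' n :
  binomial_conv x a (fun k => b k - b' k) n =
  binomial_conv x a b n - binomial_conv x a b' n.
Proof. by rewrite -sumrB; apply: eq_bigr => k _; rewrite mulrBr. Qed.

(** Pascal's rule splits each coefficient: the ['C(n, k)] part shifts [a] and leaves a factor [x],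
    the ['C(n, k.+1)] part shifts [b]. *)
Lemma binomial_convS x a b n :
  binomial_conv x a b n.+1 =
  x * binomial_conv x (a \o succn) b n + binomial_conv x a (b \o succn) n.
Proof.
rewrite /binomial_conv big_nat_recl //.
under eq_bigr => k _ do rewrite binS addnC natrD mulrDr !mulrDl subSS.
rewrite big_split /= addrCA; congr (_ + _).
  by rewrite mulr_sumr; apply: eq_bigr => k _; rewrite exprS !mulrA.
(* The detached term [k = 0] rejoins the sum because ['C(n.+1, 0)] and ['C(n, 0)] are both 1; the
   extra top term [k = n.+1] vanishes since ['C(n, n.+1) = 0]. *)
transitivity (\sum_(0 <= k < n.+2) x ^+ k * 'C(n, k)%:R * a k * b (n.+1 - k)%N).
  by rewrite [RHS]big_nat_recl // !bin0.
rewrite big_nat_recr //= bin_small // mulr0 !mul0r addr0.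
by apply: eq_big_nat => k /andP[_ kn]; rewrite subSn.
Qed.

Lemma binomial_conv_transform s t n :
  binomial_conv 1 s t n =
  binomial_conv (-1) (binomial_conv (-1) s (fun=> 1))
    (binomial_conv 1 t (fun=> 1)) n.
Proof.
elim: n s t => [|n IHn] s t.
  by rewrite /binomial_conv !big_nat1 !bin0 !expr0 !mulr1 !mul1r.
(* The induction hypothesis is used at [(s \o succn, t)] and at [(s, t \o succn)]. *)
rewrite !binomial_convS mul1r !IHn.
set sigma := binomial_conv (-1) s _; set tau := binomial_conv 1 t _.
have sE : binomial_conv (-1) (s \o succn) (fun=> 1) =1 (fun k => sigma k - sigma k.+1).
  by move=> k; rewrite [sigma k.+1]binomial_convS mulN1r opprD opprK addrCA subrr addr0.
have tE : binomial_conv 1 (t \o succn) (fun=> 1) =1 (fun k => tau k.+1 - tau k).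
  by move=> k; rewrite [tau k.+1]binomial_convS mul1r addrK.
rewrite (eq_binomial_conv _ _ sE (frefl tau)).
rewrite (eq_binomial_conv _ _ (frefl sigma) tE).
(* The two copies of the convolution of [sigma] with [tau] cancel, leaving the recurrence for
   [x = -1]. *)
by rewrite binomial_convBl binomial_convBr mulN1r [LHS]addrC subrKA addrC.
Qed.

End BinomialConvolution.

Theorem theorem8 (R : realType) (n : nat) (s sigma t tau : nat -> R[i])
    (hs : binomial_pair1 s sigma) (ht : binomial_pair2 t tau) :
  \sum_(0 <= k < n.+1) 'C(n, k)%:R * s k * t (n - k)%N =
  \sum_(0 <= k < n.+1) (-1) ^+ k * 'C(n, k)%:R * sigma k * tau (n - k)%N.
Proof.
transitivity (binomial_conv 1 s t n).
  by apply: eq_bigr => k _; rewrite expr1n mul1r.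
rewrite binomial_conv_transform; apply: eq_binomial_conv => k.
  by rewrite hs; apply: eq_bigr => i _; rewrite mulr1.
by rewrite ht; apply: eq_bigr => i _; rewrite expr1n mul1r mulr1.
Qed.
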